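(* Let $A\in\mathbb{R}^{n\times n}$ be a Google matrix, let $\bm q_0\in\mathbb{R}^n$ be a nonzero starting vector and $m\ge 1$ an integer. Let $Q_m=[\bm q_1,\ldots,\bm q_m]$, $Q_{m+1}=[\bm q_1,\ldots,\bm q_{m+1}]$ and the upper Hessenberg matrix $\bar H_m=[h_{i,j}]\in\mathbb{R}^{(m+1)\times m}$ be the matrices obtained by running $m$ steps of either the Arnoldi process or the Hessenberg process with pivoting applied to $A$ with starting vector $\bm q_0$, where no breakdown occurs during these $m$ steps. Let $H_m\in\mathbb{R}^{m\times m}$ be $\bar H_m$ with its last row deleted and let $\bm e_m$ be the last canonical basis vector of $\mathbb{R}^m$. Then, in both cases, $$AQ_m = Q_mH_m + h_{m+1,m}\,\bm q_{m+1}\bm e_m^{\top} = Q_{m+1}\bar H_m .$$ Moreover, let $\bar H_m-\begin{pmatrix} I_m\\ \bm 0\end{pmatrix}=U\Gamma V^{\top}$ be a singular value decomposition, let $\sigma_m$ be the smallest singular value of $\bar H_m-\begin{pmatrix} I_m\\ \bm 0\end{pmatrix}$, and let $\bm v_m\in\mathbb{R}^m$ and $\bm u_m\in\mathbb{R}^{m+1}$ be the corresponding right and left singular vectors (columns of $V$ and $U$). Let $\bm q=Q_m\bm v_m$ be the approximate PageRank vector computed in this cycle. Then its residual vector $\bm r = A\bm q-\bm q$ is given by $$\bm r=\sigma_m\,Q_{m+1}\bm u_m .$$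
   Context: **Google matrix.** Let $G\in\{0,1\}^{n\times n}$. Define $P\in\mathbb{R}^{n\times n}$ by $P(i,j)=1/\sum_{k=1}^n G(k,j)$ if $G(i,j)=1$ and $P(i,j)=0$ otherwise. Let $\bm d\in\{0,1\}^n$ have $\bm d(j)=1$ if the $j$-th column of $G$ is zero and $\bm d(j)=0$ otherwise. Let $\bm e=[1,\ldots,1]^\top\in\mathbb{R}^n$, let $\bm w\in\mathbb{R}^n$ satisfy $\bm w\ge 0$ and $\|\bm w\|_1=1$, and let $0<\alpha<1$. The Google matrix is $A=\alpha(P+\bm w\bm d^\top)+(1-\alpha)\bm w\bm e^\top$. The PageRank vector is the positive vector $\bm x$ with $A\bm x=\bm x$ and $\|\bm x\|_1=1$. **Arnoldi process** ($m$ steps, starting vector $\bm q_0\neq \bm 0$). Set $\bm q_1=\bm q_0/\|\bm q_0\|_2$. For $j=1,\ldots,m$: set $\bm u=A\bm q_j$; for $i=1,\ldots,j$ set $h_{i,j}=\bm q_i^\top\bm u$ and replace $\bm u$ by $\bm u-h_{i,j}\bm q_i$; then set $h_{j+1,j}=\|\bm u\|_2$ and $\bm q_{j+1}=\bm u/h_{j+1,j}$. Breakdown means that $\bm u=\bm 0$ at the end of some step $j\le m$. **Hessenberg process with pivoting** ($m$ steps, starting vector $\bm q_0\ne \bm 0$). Initialize the permutation vector $\bm p=[1,2,\ldots,n]^\top$. Choose $i_0$ with $|(\bm q_0)_{i_0}|=\|\bm q_0\|_\infty$, set $\bm q_1=\bm q_0/(\bm q_0)_{i_0}$, and swap $\bm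 p(1)$ and $\bm p(i_0)$. For $j=1,\ldots,m$: set $\bm u=A\bm q_j$; for $i=1,\ldots,j$ set $h_{i,j}=(\bm u)_{\bm p(i)}$ and replace $\bm u$ by $\bm u-h_{i,j}\bm q_i$; then, if $j<n$ and $\bm u\neq\bm 0$, choose $i_0\in\{j+1,\ldots,n\}$ with $|(\bm u)_{\bm p(i_0)}|=\max_{j+1\le k\le n}|(\bm u)_{\bm p(k)}|$, set $h_{j+1,j}=(\bm u)_{\bm p(i_0)}$ and $\bm q_{j+1}=\bm u/h_{j+1,j}$, and swap $\bm p(j+1)$ and $\bm p(i_0)$. Breakdown means that $j=n$ or $\bm u=\bm 0$ at the end of some step $j\le m$. In both processes the entries $h_{i,j}$ with $i>j+1$ are $0$, so $\bar H_m=[h_{i,j}]$ is an upper Hessenberg matrix of size $(m+1)\times m$. All matrices are real. **Restarted method.** In each restarting cycle one of the two processes is run for $m$ steps from the current starting vector $\bm q_0$, the approximate PageRank vector $\bm q=Q_m\bm v_m$ is computed, and if it is not accurate enough the next cycle is started with $\bm q_0=\bm q$. The theorem concerns a single (arbitrary) cycle. *)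

(* Defs.v *)
From mathcomp Require Import all_boot all_order all_algebra all_fingroup.
From mathcomp Require Import reals.
Set Implicit Arguments.
Unset Strict Implicit.
Unset Printing Implicit Defensive.
Import Order.TTheory GRing.Theory Num.Theory.
Local Open Scope ring_scope.

Definition norm1 (R : realType) (n : nat) (v : 'cV[R]_n) : R :=
  \sum_i `|v i 0|.

Definition norm2 (R : realType) (n : nat) (v : 'cV[R]_n) : R :=
  Num.sqrt (\sum_i v i 0 ^+ 2).

Definition norminf (R : realType) (n : nat) (v : 'cV[R]_n) : R :=
  \big[Num.max/0]_i `|v i 0|.

Definition link_matrix (R : realType) (n : nat) (G : 'M[bool]_n) : 'M[R]_n :=
  \matrix_(i, j) if G i j then (\sum_k (G k j)%:R)^-1 else 0.

Definition dangling (R : realType) (n : nat) (G : 'M[bool]_n) : 'cV[R]_n :=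
  \col_j [forall i, ~~ G i j]%:R.

Definition is_google_matrix (R : realType) (n : nat) (A : 'M[R]_n) : Prop :=
  exists (G : 'M[bool]_n) (w : 'cV[R]_n) (alpha : R),
    [/\ forall i, 0 <= w i 0,
        norm1 w = 1,
        0 < alpha < 1
      & A = alpha *: (link_matrix R G + w *m (dangling R G)^T)
            + (1 - alpha) *: (w *m (const_mx 1 : 'cV[R]_n)^T)].

(* Vectors q j and scalars h i j carry the 1-based indices of the algorithms;
   only 1 <= j <= m (and j = m + 1 for q) is meaningful in an m-step run.
   loop_vec A q h j i is the content of the work vector u in step j after the
   first i passes of the inner loop. *)
Fixpoint loop_vec (R : realType) (n : nat) (A : 'M[R]_n)
    (q : nat -> 'cV[R]_n) (h : nat -> nat -> R) (j i : nat) : 'cV[R]_n :=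
  if i is i'.+1 then loop_vec A q h j i' - h i j *: q i else A *m q j.

(* m steps of the Arnoldi process, all of them without breakdown. *)
Definition arnoldi_run (R : realType) (n : nat) (A : 'M[R]_n)
    (q0 : 'cV[R]_n) (m : nat) (q : nat -> 'cV[R]_n) (h : nat -> nat -> R) :
    Prop :=
  q 1%N = (norm2 q0)^-1 *: q0 /\
  forall j : nat, (1 <= j <= m)%N ->
    let u := loop_vec A q h j j in
    [/\ forall i : nat, (1 <= i <= j)%N ->
          h i j = ((q i)^T *m loop_vec A q h j i.-1) 0 0,
        u != 0,
        h j.+1 j = norm2 u,
        q j.+1 = (h j.+1 j)^-1 *: u
      & forall i : nat, (j.+1 < i)%N -> h i j = 0].

(* m steps of the Hessenberg process with pivoting, all of them without
   breakdown.  p j is the permutation vector used in the inner loop of step j.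
   Its positions are ordinals, so that the 1-based position i is the ordinal of
   value i - 1; exchanging the entries of p at positions k and i0 gives
   (tperm k i0 * p)%g, since (s * t)%g x = t (s x).  Ties between pivots may be
   resolved arbitrarily. *)
Definition hessenberg_run (R : realType) (n : nat) (A : 'M[R]_n)
    (q0 : 'cV[R]_n) (m : nat) (q : nat -> 'cV[R]_n) (h : nat -> nat -> R) :
    Prop :=
  exists p : nat -> 'S_n,
  [/\ p 0%N = 1%g,
      exists k i0 : 'I_n,
        [/\ k = 0%N :> nat,
            `|q0 i0 0| = norminf q0,
            q 1%N = (q0 i0 0)^-1 *: q0
          & p 1%N = (tperm k i0 * p 0%N)%g]
    & forall j : nat, (1 <= j <= m)%N ->
        let u := loop_vec A q h j j in
        [/\ forall i : 'I_n, (i < j)%N ->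
              h i.+1 j = loop_vec A q h j i (p j i) 0,
            (j < n)%N,
            u != 0,
            exists k i0 : 'I_n,
              [/\ k = j :> nat,
                  (j <= i0)%N /\
                  `|u (p j i0) 0|
                    = \big[Num.max/0]_(l < n | (j <= l)%N) `|u (p j l) 0|,
                  h j.+1 j = u (p j i0) 0,
                  q j.+1 = (h j.+1 j)^-1 *: u
                & p j.+1 = (tperm k i0 * p j)%g]
          & forall i : nat, (j.+1 < i)%N -> h i j = 0]].

Definition Qmx (R : realType) (n : nat) (q : nat -> 'cV[R]_n) (k : nat) :
    'M[R]_(n, k) :=
  \matrix_(i < n, j < k) q j.+1 i 0.

Definition Hbarmx (R : realType) (h : nat -> nat -> R) (m : nat) :
    'M[R]_(m + 1, m) :=
  \matrix_(i < m + 1, j < m) h i.+1 j.+1.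

Definition Hmx (R : realType) (h : nat -> nat -> R) (m : nat) : 'M[R]_m :=
  usubmx (Hbarmx h m).

Definition last_basis_vec (R : realType) (m : nat) : 'cV[R]_m :=
  \col_(i < m) (i.+1 == m)%:R.

Definition orthogonal_mx (R : realType) (k : nat) (U : 'M[R]_k) : Prop :=
  U^T *m U = 1%:M.

(* Full singular value decomposition of a matrix with one more row than
   columns.  The singular values gamma k k are not required to be sorted, which
   includes the sorted decompositions. *)
Definition is_svd (R : realType) (m : nat) (M : 'M[R]_(m + 1, m))
    (U : 'M[R]_(m + 1)) (gamma : 'M[R]_(m + 1, m)) (V : 'M[R]_m) : Prop :=
  [/\ orthogonal_mx U,
      orthogonal_mx V,
      is_diag_mx gamma,
      forall k : 'I_m, 0 <= gamma (lshift 1 k) k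
    & M = U *m gamma *m V^T].

(* Main.v *)
Require Import Defs.
From mathcomp Require Import all_boot all_order all_algebra all_fingroup.
From mathcomp Require Import reals.
Set Implicit Arguments.
Unset Strict Implicit.
Unset Printing Implicit Defensive.
Import Order.TTheory GRing.Theory Num.Theory.
Local Open Scope ring_scope.

(** Step j of either process subtracts the vectors [h i j *: q i], 1 <= i <= j,
    from [A *m q j] and calls the remainder [h j.+1 j *: q j.+1].  Hence
    [A *m q j] is the sum of [h i j *: q i] over 1 <= i <= j + 1, which is
    column j of the Hessenberg relation [A Q_m = Q_(m+1) Hbar_m]
    ([hessenberg_relation]); splitting off the last column of [Q_(m+1)] and the
    last row of [Hbar_m] gives its other form ([Qmx_Hbarmx_split]).

    The remainder really is [h j.+1 j *: q j.+1] only if the divisor [h j.+1 j]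
    is nonzero.  For the Arnoldi process it is the norm of a nonzero vector.
    For the Hessenberg process it is the entry of largest modulus among the
    positions [p j l] with j <= l only, so the entries at the positions [p j l]
    with l < j have to be excluded: they have all been eliminated, because the
    vectors found so far form, in the order of rows given by [p j], a unit
    lower trapezoidal matrix ([pivoted_trapezoidal], [loop_vec_eliminated]).

    For the residual, [Q_m = Q_(m+1) [I; 0]], so the relation gives
    [A Q_m v - Q_m v = Q_(m+1) (Hbar_m - [I; 0]) v], and a right singular vector
    v is mapped by [Hbar_m - [I; 0]] to sigma times the left one
    ([svd_mul_right_vector]). *)

(** * Nonvanishing of the normalizing scalars *)

Lemma norm2_neq0 (R : realType) (n : nat) (v : 'cV[R]_n) :
  v != 0 -> norm2 v != 0.
Proof.
apply: contra_neq => /eqP; rewrite sqrtr_eq0 => sum_le0.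
have sq_ge0 (i : 'I_n) : true -> 0 <= v i 0 ^+ 2 by rewrite sqr_ge0.
have /eqP : \sum_i v i 0 ^+ 2 = 0.
  by apply/eqP; rewrite eq_le sum_le0 sumr_ge0.
rewrite psumr_eq0 // => /allP v_eq0.
apply/colP => i; rewrite mxE; apply/eqP.
by have := v_eq0 i (mem_index_enum i); rewrite sqrf_eq0.
Qed.

Lemma bigmax_norm_eq0 (R : realType) (I : finType) (P : pred I) (f : I -> R) :
  \big[Num.max/0]_(i | P i) `|f i| = 0 -> forall i, P i -> f i = 0.
Proof.
move=> max0 i Pi; apply/eqP; rewrite -normr_le0 -max0.
exact: (@le_bigmax_cond _ _ _ 0 i P (fun i => `|f i|)).
Qed.

(** * The elimination invariant of the pivoted Hessenberg process *)

(** The first [j] vectors, read in the order of rows [s], are the columns of a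
    unit lower trapezoidal matrix.  The column of value [i] is [q i.+1], since
    the processes number their vectors from 1. *)
Definition pivoted_trapezoidal (R : realType) (n : nat) (q : nat -> 'cV[R]_n)
    (s : 'S_n) (j : nat) : Prop :=
  forall i l : 'I_n, (i < j)%N -> (l <= i)%N -> q i.+1 (s l) 0 = (l == i)%:R.

(** Pass [i] annihilates the entry at the pivot position of [q i], where [q i]
    is 1, and does not disturb the entries annihilated before, where [q i] is
    0. *)
Lemma loop_vec_eliminated (R : realType) (n : nat) (A : 'M[R]_n)
    (q : nat -> 'cV[R]_n) (h : nat -> nat -> R) (s : 'S_n) (j : nat) :
  pivoted_trapezoidal q s j ->
  (forall i : 'I_n, (i < j)%N -> h i.+1 j = loop_vec A q h j i (s i) 0) ->
  forall (i : nat) (l : 'I_n), (i <= j)%N -> (i <= n)%N -> (l < i)%N ->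
    loop_vec A q h j i (s l) 0 = 0.
Proof.
move=> trap hE; elim=> [//|i IHi] l lt_ij lt_in.
rewrite ltnS /= !mxE => le_li.
have -> := trap (Ordinal lt_in) l lt_ij le_li.
case: (eqVneq l (Ordinal lt_in)) => [->|ne_li].
  by rewrite mulr1 (hE (Ordinal lt_in)) //= subrr.
rewrite mulr0n mulr0 subr0 IHi ?(ltnW lt_ij) ?(ltnW lt_in) //.
by rewrite ltn_neqAle le_li andbT.
Qed.

(** A zero pivot would make the remainder vanish at the positions from [j] on,
    in addition to the eliminated positions before [j], hence everywhere. *)
Lemma pivot_neq0 (R : realType) (n : nat) (u : 'cV[R]_n) (s : 'S_n) (j : nat)
    (i0 : 'I_n) :
  u != 0 ->
  (forall l : 'I_n, (l < j)%N -> u (s l) 0 = 0) ->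
  `|u (s i0) 0| = \big[Num.max/0]_(l < n | (j <= l)%N) `|u (s l) 0| ->
  u (s i0) 0 != 0.
Proof.
move=> u_neq0 elim_u maxE; apply: contra_neq u_neq0 => piv0.
apply/colP => x; rewrite mxE -(permKV s x).
have [lt_xj | le_jx] := ltnP (s^-1%g x) j; first exact: elim_u.
apply: (bigmax_norm_eq0 (P := fun l : 'I_n => (j <= l)%N)
                        (f := fun l => u (s l) 0)) => //.
by rewrite -maxE piv0 normr0.
Qed.

(** Only positions from [j] on are exchanged, so the rows already in place stay
    there, and the pivot row is moved to position [j]. *)
Lemma pivoted_trapezoidal_step (R : realType) (n : nat) (q : nat -> 'cV[R]_n)
    (u : 'cV[R]_n) (s : 'S_n) (k i0 : 'I_n) :
  pivoted_trapezoidal q s k -> (k <= i0)%N ->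
  (forall l : 'I_n, (l < k)%N -> u (s l) 0 = 0) ->
  u (s i0) 0 != 0 -> q k.+1 = (u (s i0) 0)^-1 *: u ->
  pivoted_trapezoidal q (tperm k i0 * s)%g k.+1.
Proof.
move=> trap le_ki0 elim_u piv qE i l; rewrite ltnS => le_ik le_li.
have fixed (x : 'I_n) : (x < k)%N -> (tperm k i0 * s)%g x = s x.
  move=> lt_xk; rewrite permM tpermD // -val_eqE /= gtn_eqF //.
  exact: leq_trans lt_xk le_ki0.
have [lt_ik | ge_ik] := ltnP i k.
  by rewrite fixed ?trap // (leq_ltn_trans le_li).
have {ge_ik le_ik} eik : i = k by apply/val_inj/eqP; rewrite eqn_leq le_ik ge_ik.
rewrite eik in le_li *; rewrite qE mxE; case: (eqVneq l k) => [->|ne_lk].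
  by rewrite permM tpermL mulVf.
have lt_lk : (l < k)%N by rewrite ltn_neqAle le_li andbT.
by rewrite fixed // (elim_u l) // mulr0.
Qed.

(** * The recurrence shared by the two processes *)

(** The common ground of the two processes: they differ in how the coefficients
    are chosen, and the matrix relations do not see that choice. *)
Definition hessenberg_recurrence (R : realType) (n m : nat) (A : 'M[R]_n)
    (q : nat -> 'cV[R]_n) (h : nat -> nat -> R) : Prop :=
  forall j : nat, (1 <= j <= m)%N ->
    loop_vec A q h j j = h j.+1 j *: q j.+1 /\
    forall i : nat, (j.+1 < i)%N -> h i j = 0.

Lemma arnoldi_run_recurrence (R : realType) (n m : nat) (A : 'M[R]_n)
    (q0 : 'cV[R]_n) (q : nat -> 'cV[R]_n) (h : nat -> nat -> R) :
  arnoldi_run A q0 m q h -> hessenberg_recurrence m A q h.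
Proof.
move=> [_ run] j /run[_ u_neq0 hE qE h0]; split=> //.
by rewrite qE scalerA divff ?scale1r // hE norm2_neq0.
Qed.

Lemma hessenberg_run_recurrence (R : realType) (n m : nat) (A : 'M[R]_n)
    (q0 : 'cV[R]_n) (q : nat -> 'cV[R]_n) (h : nat -> nat -> R) :
  q0 != 0 -> hessenberg_run A q0 m q h -> hessenberg_recurrence m A q h.
Proof.
move=> q0_neq0 [p [p0 [k [i0 [k0 maxE q1E p1E]]] run]].
have step j : (1 <= j <= m)%N -> pivoted_trapezoidal q (p j) j ->
    pivoted_trapezoidal q (p j.+1) j.+1 /\
    loop_vec A q h j j = h j.+1 j *: q j.+1.
  move=> jm trap.
  have [hE lt_jn u_neq0 [k' [i' [k'E [le_ji' maxE'] hpiv qE pE]]] _] := run j jm.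
  subst j.
  have elim_u (l : 'I_n) : (l < k')%N -> loop_vec A q h k' k' (p k' l) 0 = 0.
    by apply: loop_vec_eliminated => //; apply: ltnW.
  have piv := pivot_neq0 u_neq0 elim_u maxE'.
  split; last by rewrite qE scalerA hpiv divff // scale1r.
  by rewrite pE; apply: pivoted_trapezoidal_step elim_u piv _; rewrite // -hpiv.
(* Choosing the first pivot is a step with remainder [q0] and no vector yet. *)
have trap1 : pivoted_trapezoidal q (p 1%N) 1.
  rewrite p1E p0 -k0; apply: (pivoted_trapezoidal_step (u := q0)).
  - by move=> i l; rewrite k0.
  - by rewrite k0.
  - by move=> l; rewrite k0.
  - apply: (@pivot_neq0 _ _ _ _ 0) => //; rewrite perm1 maxE.
    by apply: eq_bigr => l _; rewrite perm1.
  - by rewrite k0 perm1.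
have trap j : (j <= m)%N -> pivoted_trapezoidal q (p j.+1) j.+1.
  by elim: j => [//|j IHj] lt_jm; have [] := step j.+1 lt_jm (IHj (ltnW lt_jm)).
case=> [//|j] jm; have [_ ->] := step _ jm (trap j (ltnW jm)).
by split=> //; have [] := run _ jm.
Qed.

(** * Matrix form of the recurrence *)

Lemma loop_vecE (R : realType) (n : nat) (A : 'M[R]_n) (q : nat -> 'cV[R]_n)
    (h : nat -> nat -> R) (j i : nat) :
  loop_vec A q h j i = A *m q j - \sum_(k < i) h k.+1 j *: q k.+1.
Proof.
elim: i => [|i IHi] /=; first by rewrite big_ord0 subr0.
by rewrite IHi big_ord_recr opprD addrA.
Qed.

Lemma Qmx_split (R : realType) (n : nat) (q : nat -> 'cV[R]_n) (m : nat) :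
  Qmx q (m + 1) = row_mx (Qmx q m) (q m.+1).
Proof.
apply/matrixP => i j; rewrite !mxE.
by case: splitP => l jE; rewrite ?mxE jE // ord1 addn0.
Qed.

(** The coefficients [h i.+1 j.+1] with [j.+1 < i] vanish, which extends the sum
    over [i <= j.+1] given by the recurrence to all the columns of
    [Q_(m+1)]. *)
Lemma hessenberg_relation (R : realType) (n m : nat) (A : 'M[R]_n)
    (q : nat -> 'cV[R]_n) (h : nat -> nat -> R) :
  hessenberg_recurrence m A q h ->
  A *m Qmx q m = Qmx q (m + 1) *m Hbarmx h m.
Proof.
move=> rec; apply/matrixP => x j.
have jm : (1 <= j.+1 <= m)%N by rewrite ltn_ord.
have [uE h0] := rec j.+1 jm.
have Aq : A *m q j.+1 = \sum_(i < j.+2) h i.+1 j.+1 *: q i.+1.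
  by rewrite big_ord_recr /= -uE loop_vecE addrC subrK.
have -> : (A *m Qmx q m) x j = (A *m q j.+1) x 0.
  by rewrite !mxE; apply: eq_bigr => i _; rewrite !mxE.
rewrite Aq (big_ord_widen (m + 1) (fun i => h i.+1 j.+1 *: q i.+1)).
  rewrite big_mkcond summxE mxE; apply: eq_bigr => i _; rewrite !mxE.
  case: ltnP => [_|le_ji]; first by rewrite mxE mulrC.
  by rewrite h0 ?mxE ?mulr0 // ltnS.
by rewrite addn1 ltnS.
Qed.

Lemma Qmx_Hbarmx_split (R : realType) (n m : nat) (A : 'M[R]_n)
    (q : nat -> 'cV[R]_n) (h : nat -> nat -> R) :
  hessenberg_recurrence m A q h ->
  Qmx q (m + 1) *m Hbarmx h m
    = Qmx q m *m Hmx h m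
      + h m.+1 m *: (q m.+1 *m (last_basis_vec R m)^T).
Proof.
move=> rec.
have last_row : dsubmx (Hbarmx h m) = h m.+1 m *: (last_basis_vec R m)^T.
  apply/matrixP => i j; rewrite !mxE /= ord1 addn0.
  case: (eqVneq j.+1 m) => [->|ne_jm]; first by rewrite mulr1.
  have lt_jm : (j.+1 < m)%N by rewrite ltn_neqAle ne_jm ltn_ord.
  by have [_ ->] := rec j.+1 (ltnW lt_jm); rewrite ?ltnS // mulr0n mulr0.
by rewrite Qmx_split -[Hbarmx h m]vsubmxK mul_row_col last_row -scalemxAr.
Qed.

(** * Singular vectors and the residual *)

Lemma svd_mul_right_vector (R : realType) (m : nat) (M : 'M[R]_(m + 1, m))
    (U : 'M[R]_(m + 1)) (gamma : 'M[R]_(m + 1, m)) (V : 'M[R]_m) (k : 'I_m) :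
  is_svd M U gamma V ->
  M *m col k V = gamma (lshift 1 k) k *: col (lshift 1 k) U.
Proof.
move=> [_ orthV /is_diag_mxP diag_gamma _ ->].
have gammaE : gamma *m delta_mx k 0
    = gamma (lshift 1 k) k *: delta_mx (lshift 1 k) (0 : 'I_1).
  rewrite -colE; apply/colP => i; rewrite !mxE eqxx andbT.
  case: (eqVneq i (lshift 1 k)) => [->|ne_ik]; first by rewrite mulr1.
  by rewrite diag_gamma ?mulr0n ?mulr0.
by rewrite !colE -mulmxA (mulmxA V^T) orthV mul1mx -mulmxA gammaE -scalemxAr.
Qed.

Theorem theorem3p1 (R : realType) (n m : nat) (A : 'M[R]_n) (q0 : 'cV[R]_n)
    (q : nat -> 'cV[R]_n) (h : nat -> nat -> R)
    (hA : is_google_matrix A) (hq0 : q0 != 0) (hm : (1 <= m)%N)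
    (hrun : arnoldi_run A q0 m q h \/ hessenberg_run A q0 m q h) :
  [/\ A *m Qmx q m
        = Qmx q m *m Hmx h m
          + h m.+1 m *: (q m.+1 *m (last_basis_vec R m)^T),
      Qmx q m *m Hmx h m + h m.+1 m *: (q m.+1 *m (last_basis_vec R m)^T)
        = Qmx q (m + 1) *m Hbarmx h m
    & forall (U : 'M[R]_(m + 1)) (gamma : 'M[R]_(m + 1, m)) (V : 'M[R]_m)
        (k : 'I_m) (sigma : R) (u : 'cV[R]_(m + 1)) (v : 'cV[R]_m)
        (qapp r : 'cV[R]_n),
        is_svd (Hbarmx h m - col_mx 1%:M 0) U gamma V ->
        sigma = gamma (lshift 1 k) k ->
        (forall l : 'I_m, sigma <= gamma (lshift 1 l) l) ->
        v = col k V ->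
        u = col (lshift 1 k) U ->
        qapp = Qmx q m *m v ->
        r = A *m qapp - qapp ->
        r = sigma *: (Qmx q (m + 1) *m u)].
Proof.
have rec : hessenberg_recurrence m A q h.
  case: hrun; first exact: arnoldi_run_recurrence.
  exact: hessenberg_run_recurrence.
have AQ := hessenberg_relation rec; have QH := Qmx_Hbarmx_split rec.
split; [by rewrite AQ QH | by rewrite QH |].
move=> U gamma V k sigma u v qapp r svd -> _ vE -> -> ->.
have QmE : Qmx q m = Qmx q (m + 1) *m col_mx 1%:M 0.
  by rewrite Qmx_split mul_row_col mulmx1 mulmx0 addr0.
rewrite mulmxA AQ QmE -mulmxBl -mulmxBr -mulmxA vE.
by rewrite (svd_mul_right_vector k svd) -scalemxAr.
Qed.
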